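(* There exist $c>0$ and $\varepsilon>0$ such that for every $\lambda$ with $1-\varepsilon<\lambda<1$ the Bernoulli convolution measure $\mu_\lambda$ satisfies $\dim_H(\mu_\lambda)\ge 1-c(1-\lambda)$.
   Context: For $0<\lambda<1$ the Bernoulli convolution measure $\mu_\lambda$ is the law of the random variable $\xi=\sum_{k=0}^\infty \xi_k\lambda^k$, where $\xi_k$ are i.i.d. random variables taking the values $-1$ and $1$ with probability $\frac12$ each. The Hausdorff dimension of a Borel probability measure $\mu$ on $\mathbb R$ is $\dim_H(\mu)=\inf\{\dim_H(X)\mid X \text{ is a Borel set with } \mu(X)=1\}$, where $\dim_H(X)$ is the usual Hausdorff dimension of the set $X$. *)

(* Defs.v *)
From HB Require Import structures.
From mathcomp Require Import all_boot all_order all_algebra.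
From mathcomp Require Import all_classical all_reals all_analysis.
Set Implicit Arguments.
Unset Strict Implicit.
Unset Printing Implicit Defensive.
Import Order.TTheory GRing.Theory Num.Theory.
Import numFieldNormedType.Exports.
Local Open Scope classical_set_scope.
Local Open Scope ring_scope.

Section hausdorff.
Context {R : realType}.
Implicit Types (A U : set R) (s delta : R).

(* The added point 0 makes diameter set0 = 0 (ereal_sup set0 is -oo). *)
Definition diameter U : \bar R :=
  ereal_sup ([set 0%E] `|` [set (`|x - y|)%:E | x in U & y in U]).

(* diam(U)^s, with 0^0 = 1 for singletons but value 0 on the empty set, so that
   the 0-dimensional Hausdorff measure is the counting measure. *)
Definition diameter_pow s U : \bar R :=
  if U == set0 then 0%E else poweR (diameter U) s.

Definition hausdorff_premeasure s delta A : \bar R :=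
  ereal_inf [set (\sum_(0 <= i <oo) diameter_pow s (U i))%E | U in
    [set U : (set R)^nat | A `<=` \bigcup_i U i /\
                           forall i, (diameter (U i) <= delta%:E)%E]].

Definition hausdorff_measure s A : \bar R :=
  ereal_sup [set hausdorff_premeasure s delta A | delta in
    [set delta | 0 < delta]].

Definition hausdorff_dim A : \bar R :=
  ereal_inf [set s%:E | s in [set s | 0 <= s /\ hausdorff_measure s A = 0%E]].

Definition hausdorff_dim_measure (mu : probability R R) : \bar R :=
  ereal_inf [set hausdorff_dim X | X in
    [set X : set R | measurable X /\ mu X = 1%E]].

End hausdorff.

(* Product rule over every finite subfamily, given by a duplicate-free
   sequence J of indices. *)
Definition mutually_independent {d : measure_display} {T : measurableType d}
    {R : realType} (P : probability T R) (xi : nat -> {RV P >-> R}) : Prop :=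
  forall (J : seq nat) (B : nat -> set R),
    uniq J -> (forall k, measurable (B k)) ->
    P (\bigcap_(k in [set` J]) (xi k @^-1` B k)) =
    \big[*%E/1%E]_(k <- J) P (xi k @^-1` B k).

Definition fair_sign {d : measure_display} {T : measurableType d}
    {R : realType} (P : probability T R) (X : {RV P >-> R}) : Prop :=
  P (X @^-1` [set 1]) = (2^-1)%:E /\ P (X @^-1` [set -1]) = (2^-1)%:E.

(* mu is the law of sum_k xi_k lambda^k. The values of the xi_k are only
   prescribed almost surely, so the series converges to X almost surely. *)
Definition is_bernoulli_convolution {R : realType} (lambda : R)
    (mu : probability R R) : Prop :=
  exists (d : measure_display) (T : measurableType d) (P : probability T R)
         (xi : nat -> {RV P >-> R}) (X : {RV P >-> R}),
    [/\ mutually_independent xi,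
        forall k, fair_sign (xi k),
        {ae P, forall w, series (fun k => xi k w * lambda ^+ k) @ \oo --> X w} &
        forall A : set R, measurable A -> mu A = distribution P X A].

(* Main.v *)
(* The law of the difference of two independent copies of the n-th partial sum
   is controlled by a Gaussian supersolution: with a suitable variance,
   psi(x) = exp (- a x^2) satisfies, on the whole line,
     (psi ((x-2)/l) + 2 psi (x/l) + psi ((x+2)/l)) / 4 <= q psi x,
   q = (1 + exp (- (1 - l^2))) / 2 = l + O((1 - l)^2), by cosh u <= exp (u^2/2).
   Iterating, two copies are within O(l^n) of each other with probability
   O(q^n), where q <= l^(1 - 5 (1 - l)) once l > 1/2: the correlation dimension
   is at least 1 - 5 (1 - l). Hence for s < 1 - 5 (1 - l) a set of positive
   measure satisfies mu (B (x, l^n)) <= K l^(s n) for all n, and the mass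
   distribution principle bounds the Hausdorff dimension from below. *)
Require Import Defs.
From mathcomp Require Import all_boot all_order all_algebra.
From mathcomp Require Import all_classical all_reals all_analysis.
From mathcomp Require Import measurable_realfun ring lra.
Import Order.TTheory GRing.Theory Num.Theory.
Import numFieldNormedType.Exports.
Local Open Scope classical_set_scope.
Local Open Scope ring_scope.

(** * Gaussian inequalities and the contraction rate *)

(** This is [tanh u <= u]: the difference [h] vanishes at 0 and has derivative [- 2 x sinh x],
    nonpositive for [x >= 0]. *)
Lemma sinh_le_mul_cosh (R : realType) (u : R) : 0 <= u ->
  expR u - expR (- u) <= u * (expR u + expR (- u)).
Proof.
move=> u0.
pose h (x : R) := expR x - expR (- x) - x * (expR x + expR (- x)).
have dh (x : R) : is_derive x 1 h (- (x * (expR x - expR (- x)))).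
  rewrite /h; apply: is_derive_eq.
  rewrite /GRing.scale /=; ring.
have : h u <= h 0.
  apply: (@ler0_derive1_nincry _ h 0) => //.
  - move=> x; rewrite in_itv /= andbT => x0.
    rewrite derive1E (derive_val (is_derive := dh x)) oppr_le0 mulr_ge0 ?ltW //.
    by rewrite subr_gt0 ltr_expR; lra.
  - apply: derivable_within_continuous => x _.
    by case: (dh x) => D _; exact: D.
by rewrite /h oppr0 expR0; lra.
Qed.

(** The function [g], which is [2 cosh x * exp (- x ^ 2 / 2)], starts at 2 and is nonincreasing: its
    derivative has the sign of [sinh x - x cosh x]. *)
Lemma cosh_le_gauss_ge0 (R : realType) (u : R) : 0 <= u ->
  expR u + expR (- u) <= 2 * expR (u ^+ 2 / 2).
Proof.
move=> u0.
pose g (x : R) := (expR x + expR (- x)) * expR (- (x ^+ 2 / 2)).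
have dg (x : R) : is_derive x 1 g
    ((expR x - expR (- x) - x * (expR x + expR (- x))) * expR (- (x ^+ 2 / 2))).
  rewrite /g; apply: is_derive_eq.
  by rewrite /GRing.scale /=; field.
have : g u <= g 0.
  apply: (@ler0_derive1_nincry _ g 0) => //.
  - move=> x; rewrite in_itv /= andbT => x0.
    rewrite derive1E (derive_val (is_derive := dg x)).
    rewrite mulr_le0_ge0 ?expR_ge0 // subr_le0.
    by apply: sinh_le_mul_cosh; rewrite ltW.
  - apply: derivable_within_continuous => x _.
    by case: (dg x) => D _; exact: D.
have E0 := expR_gt0 (u ^+ 2 / 2).
rewrite /g expr0n /= mul0r oppr0 expR0 (expRN (u ^+ 2 / 2)) ler_pdivrMr //.
by lra.
Qed.

Lemma cosh_le_gauss (R : realType) (u : R) :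
  expR u + expR (- u) <= 2 * expR (u ^+ 2 / 2).
Proof.
have [u0|u0] := leP 0 u; first exact: cosh_le_gauss_ge0.
have := @cosh_le_gauss_ge0 R (- u); rewrite opprK sqrrN addrC; apply.
by rewrite oppr_ge0 ltW.
Qed.

(* With [b = 1 - l ^ 2], the exponent is chosen so that after dividing by
   [expR (- b x ^ 2 / 4)] the supersolution inequality below is exactly
   [cosh u <= exp (u ^ 2 / 2)] at [u = b x / 2]. *)
Definition gauss_bump {R : realType} (l x : R) : R :=
  expR (- (l ^+ 2 * (1 - l ^+ 2) / 4 * x ^+ 2)).

Definition gauss_rate {R : realType} (l : R) : R :=
  (1 + expR (- (1 - l ^+ 2))) / 2.

Lemma gauss_bump_supersolution (R : realType) (l x : R) : 0 < l < 1 ->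
  gauss_bump l ((x - 2) / l) + 2 * gauss_bump l (x / l)
    + gauss_bump l ((x + 2) / l)
    <= 4 * (gauss_rate l * gauss_bump l x).
Proof.
move=> /andP[l0 l1]; rewrite /gauss_bump /gauss_rate.
set b := 1 - l ^+ 2.
have b0 : 0 <= b by rewrite subr_ge0 exprn_ile1 // ltW.
have eb1 : expR (- b) <= 1 by rewrite -expR0 ler_expR; lra.
have simp (y : R) : l ^+ 2 * b / 4 * (y / l) ^+ 2 = b / 4 * y ^+ 2.
  by field; rewrite gt_eqF.
rewrite !simp.
set z := b * x / 2.
set E := expR (- (b / 4 * x ^+ 2)).
have -> : expR (- (b / 4 * (x - 2) ^+ 2)) = E * expR (- b) * (expR z) ^+ 2.
  by rewrite (expr2 (expR _)) /E -!expRD; congr expR; rewrite /z; field.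
have -> : expR (- (b / 4 * (x + 2) ^+ 2)) = E * expR (- b) * (expR (- z)) ^+ 2.
  by rewrite (expr2 (expR _)) /E -!expRD; congr expR; rewrite /z; field.
have -> : expR (- (l ^+ 2 * b / 4 * x ^+ 2)) = E * expR (z ^+ 2 / 2) ^+ 2.
  rewrite (expr2 (expR _)) /E -!expRD; congr expR; rewrite /z.
  have -> : l ^+ 2 = 1 - b by rewrite /b; ring.
  by field.
have zz : expR z * expR (- z) = 1 by rewrite expRN divff // gt_eqF ?expR_gt0.
have G1 : 1 <= expR (z ^+ 2 / 2) ^+ 2.
  by rewrite exprn_ege1 // -expR0 ler_expR divr_ge0 // sqr_ge0.
have CG : (expR z + expR (- z)) ^+ 2 <= 4 * expR (z ^+ 2 / 2) ^+ 2.
  have -> : 4 * expR (z ^+ 2 / 2) ^+ 2 = (2 * expR (z ^+ 2 / 2)) ^+ 2 by ring.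
  rewrite ler_sqr ?cosh_le_gauss // nnegrE ?addr_ge0 ?mulr_ge0 ?expR_ge0 //.
have E0 : 0 <= E by exact: expR_ge0.
have e0 : 0 <= expR (- b) by exact: expR_ge0.
move: E0 e0 eb1 G1 CG zz.
move: E (expR (- b)) (expR z) (expR (- z)) (expR (z ^+ 2 / 2) ^+ 2).
move=> E e p m G.
move=> E0 e0 e1 G1 CG pm.
(* Both sides become combinations with weights [2 (1 - e)] and [e], compared term by term: [1 <= G]
   and, since [p m = 1], [p ^ 2 + 2 + m ^ 2 = (p + m) ^ 2 <= 4 G]. *)
rewrite -[leRHS](_ : E * (2 * (1 - e) * G + e * (4 * G)) = _); last by field.
rewrite -[leLHS](_ : E * (2 * (1 - e) + e * (p + m) ^+ 2) = _); last first.
  by rewrite sqrrD pm; ring.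
rewrite ler_wpM2l // lerD ?(ler_wpM2l e0) //.
by rewrite -[leLHS]mulr1 ler_wpM2l //; lra.
Qed.

(** With [t = 1 - l], the rate is at most [1 - t + 5 t ^ 2 / 2], while the right side is at least
    [l (1 + 5 t ^ 2) = 1 - t + 5 l t ^ 2]. For [l > 1/2] the latter dominates; this is where the
    constant 5 comes from. *)
Lemma gauss_rate_le_powR (R : realType) (l : R) : 2^-1 < l < 1 ->
  gauss_rate l <= l `^ (1 - 5 * (1 - l)).
Proof.
move=> /andP[l2 l1]; have l0 : 0 < l by lra.
rewrite /gauss_rate.
set b := 1 - l ^+ 2.
have b0 : 0 <= b by rewrite subr_ge0 exprn_ile1 // ltW.
have bl : b <= 2 * (1 - l) by rewrite /b; nra.
have eb : expR (- b) <= 1 - b + b ^+ 2.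
  rewrite expRN -div1r ler_pdivrMr ?expR_gt0 //.
  have := expR_ge1Dx b; nra.
have lnl : ln l <= l - 1.
  have := expR_ge1Dx (ln l); rewrite lnK ?posrE //; lra.
rewrite powRB; last by rewrite (gt_eqF l0) implybT.
rewrite (powRr1 (ltW l0)) ler_pdivlMr ?powR_gt0 //.
rewrite /powR (gt_eqF l0).
have d0 : 0 < 1 + 5 * (1 - l) ^+ 2 by rewrite ltr_pwDl // mulr_ge0 // sqr_ge0.
have e1 : expR (5 * (1 - l) * ln l) <= (1 + 5 * (1 - l) ^+ 2)^-1.
  rewrite -[_ * ln l]opprK expRN lef_pV2 ?posrE ?expR_gt0 //.
  apply: le_trans (expR_ge1Dx _); nra.
have q0 : 0 <= (1 + expR (- b)) / 2 by have := expR_ge0 (- b); lra.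
apply: (le_trans (ler_wpM2l q0 e1)).
rewrite ler_pdivrMr //.
have b2 : b ^+ 2 <= (2 * (1 - l)) ^+ 2 by rewrite ler_sqr ?nnegrE //; lra.
have l3 : 0 <= (l - 2^-1) * (1 - l) ^+ 2 by rewrite mulr_ge0 ?sqr_ge0 //; lra.
have bE : b = 2 * (1 - l) - (1 - l) ^+ 2 by rewrite /b; ring.
move: b bE b2 eb {bl b0 q0 e1 d0} => b bE b2 eb.
by nra.
Qed.

(** * Sign words and the count of close pairs *)

(** The head of a word is its coefficient of degree 0 in [horner_rec], so prepending a sign [a] maps
    the value [y] to [y * l + a]. *)
Fixpoint sign_words (R : realType) (n : nat) : seq (seq R) :=
  if n is m.+1 then
    [seq 1 :: w | w <- sign_words R m] ++ [seq -1 :: w | w <- sign_words R m]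
  else [:: [::]].

Lemma big_sign_words (R : realType) (V : nmodType) n (F : seq R -> V) :
  \sum_(w <- sign_words R n.+1) F w =
  \sum_(w <- sign_words R n) F (1 :: w) + \sum_(w <- sign_words R n) F (-1 :: w).
Proof. by rewrite /= big_cat !big_map. Qed.

(** Induction over the first letters: their difference is -2, 0, 0 or 2, and division by [l] turns
    it into a shift of [x], which is why [x] is arbitrary. The four blocks recombine by one use of
    the supersolution inequality. *)
Lemma gauss_pair_sum (R : realType) (l : R) n x : 0 < l < 1 ->
  \sum_(v <- sign_words R n) \sum_(w <- sign_words R n)
    gauss_bump l ((x + (horner_rec v l - horner_rec w l)) / l ^+ n)
  <= (4 * gauss_rate l) ^+ n * gauss_bump l x.
Proof.
move=> l01; have /andP[l0 l1] := l01.
elim: n x => [|n IH] x.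
  by rewrite /= !big_seq1 /= subrr addr0 expr0 divr1 mul1r.
have q0 : 0 <= (4 * gauss_rate l) ^+ n.
  by rewrite exprn_ge0 // /gauss_rate; have := expR_ge0 (- (1 - l ^+ 2)); lra.
rewrite big_sign_words.
under eq_bigr do rewrite big_sign_words.
rewrite big_split /=.
under [X in _ + X]eq_bigr do rewrite big_sign_words.
rewrite [X in _ + X]big_split /=.
have step (a c : R) (t : R) : a - c = t ->
  \sum_(v <- sign_words R n) \sum_(w <- sign_words R n)
    gauss_bump l ((x + (horner_rec v l * l + a - (horner_rec w l * l + c)))
       / l ^+ n.+1) <= (4 * gauss_rate l) ^+ n * gauss_bump l ((x + t) / l).
  move=> <-; apply: le_trans (IH _).
  apply: ler_sum => v _; apply: ler_sum => w _.
  rewrite le_eqVlt; apply/orP; left; apply/eqP; congr gauss_bump.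
  by rewrite exprS; field; rewrite ?expf_neq0 ?gt_eqF.
apply: (le_trans (lerD (lerD (step _ _ 0 _) (step _ _ 2 _))
                       (lerD (step _ _ (-2) _) (step _ _ 0 _)))).
- by rewrite subrr.
- by lra.
- by lra.
- by lra.
rewrite addr0 exprSr -mulrA; apply: le_trans (ler_wpM2l q0 _); last first.
  by rewrite -mulrA; exact: gauss_bump_supersolution.
by rewrite le_eqVlt; apply/orP; left; apply/eqP; ring.
Qed.

(** A Chernoff bound: every close pair contributes at least [gauss_bump l L] to the sum in
    [gauss_pair_sum] at [x = 0]. *)
Lemma near_pair_count (R : realType) (l L : R) n : 0 < l < 1 -> 0 <= L ->
  \sum_(v <- sign_words R n) \sum_(w <- sign_words R n)
    (`|horner_rec v l - horner_rec w l| <= L * l ^+ n)%R%:R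
  <= (4 * gauss_rate l) ^+ n / gauss_bump l L.
Proof.
move=> l01 L0; have /andP[l0 l1] := l01.
have gL : 0 < gauss_bump l L by exact: expR_gt0.
rewrite ler_pdivlMr // mulr_suml.
have := gauss_pair_sum R l n 0 l01.
rewrite {2}/gauss_bump expr0n mulr0 oppr0 expR0 mulr1 => H.
apply: (le_trans _ H) => {H}.
apply: ler_sum => v _; rewrite mulr_suml; apply: ler_sum => w _.
have [H|_] /= := leP `|horner_rec v l - horner_rec w l| (L * l ^+ n);
  last first.
  by rewrite mul0r expR_ge0.
rewrite mul1r add0r /gauss_bump ler_expR lerN2 ler_wpM2l //.
  by rewrite divr_ge0 // mulr_ge0 ?sqr_ge0 // subr_ge0 exprn_ile1 // ltW.
rewrite -(real_normK (num_real (_ / _))) ler_sqr ?nnegrE //.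
by rewrite normrM normfV (ger0_norm (exprn_ge0 n (ltW l0))) ler_pdivrMr //
  exprn_gt0.
Qed.

Lemma mem_sign_words (R : realType) n (w : seq R) :
  (w \in sign_words R n) = (size w == n) && all (fun a => a \in [:: 1; -1]) w.
Proof.
elim: n w => [|n IH] [|a w] //=.
  by rewrite mem_cat; apply/negbTE/negP => /orP[] /mapP[].
have mem_cons (b : R) :
    (a :: w \in [seq b :: w0 | w0 <- sign_words R n]) =
    (a == b) && (w \in sign_words R n).
  apply/mapP/andP => [[v vn [-> ->]]|[/eqP -> wn]]; last by exists w.
  by rewrite eqxx.
by rewrite mem_cat !mem_cons IH !inE eqSS -andb_orl andbCA.
Qed.

(** * From sign words to the law of the random series *)

Lemma horner_rec_series (R : realType) (x : nat -> R) (l : R) n :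
  horner_rec (mkseq x n) l = series (fun k => x k * l ^+ k) n.
Proof.
elim: n x => [|n IH] x; first by rewrite /series /= big_nil.
rewrite /series /= big_nat_recl // expr0 mulr1 addrC; congr (_ + _).
rewrite -/(mkseq _ _).
have -> : [seq x i | i <- iota 1 n] = mkseq (x \o S) n.
  by rewrite /mkseq -[1%N]addn0 iotaDl -map_comp.
by rewrite IH /series /= mulr_suml; apply: eq_bigr => k _; rewrite exprSr mulrA.
Qed.

Lemma series_tail_le (R : realType) (x : nat -> R) (l X : R) n : 0 < l < 1 ->
  (forall k, `|x k| <= 1) ->
  series (fun k => x k * l ^+ k) @ \oo --> X ->
  `|X - series (fun k => x k * l ^+ k) n| <= l ^+ n / (1 - l).
Proof.
move=> /andP[l0 l1] x1; set S := series _ => SX.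
(* The term [- l ^+ (n + m)] lets the induction on [m] close: its decrease pays for each new
   summand. *)
have part m : `|S (n + m)%N - S n| <= (l ^+ n - l ^+ (n + m)) / (1 - l).
  elim: m => [|m IH]; first by rewrite addn0 !subrr normr0 mul0r.
  have -> : S (n + m.+1)%N = S (n + m)%N + x (n + m)%N * l ^+ (n + m).
    by rewrite /S addnS seriesSr.
  rewrite addrAC; apply: (le_trans (ler_normD _ _)).
  apply: (le_trans (lerD IH (lexx _))).
  rewrite normrM normrX (gtr0_norm l0) addnS exprSr.
  have lp : 0 < l ^+ (n + m) by rewrite exprn_gt0.
  rewrite -lerBrDl -mulrBl ler_pdivlMr ?subr_gt0 //.
  have := ler_wpM2r (mulr_ge0 (ltW lp) (ltW (_ : 0 < 1 - l))) (x1 (n + m)%N).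
  by rewrite subr_gt0 => /(_ l1); lra.
have cvgn : `|S (m + n)%N - S n| @[m --> \oo] --> `|X - S n|.
  apply: cvg_norm; apply: cvgB; last exact: cvg_cst.
  by have := SX; rewrite -(cvg_shiftn n).
rewrite -(cvg_lim _ cvgn) //; apply: limr_le.
  by apply/cvg_ex; eexists; exact: cvgn.
apply: nearW => m; rewrite addnC (le_trans (part m)) //.
by rewrite ler_pM2r ?invr_gt0 ?subr_gt0 // gerBl exprn_ge0 // ltW.
Qed.

Lemma measure_bigsetU_le (R : realType) (d : measure_display)
    (T : measurableType d) (P : {measure set T -> \bar R}) (I : Type)
    (s : seq I) (A : I -> set T) :
  (forall i, measurable (A i)) ->
  (P (\big[setU/set0]_(i <- s) A i) <= \sum_(i <- s) P (A i))%E.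
Proof.
move=> mA; elim: s => [|i s IH]; first by rewrite !big_nil measure0.
rewrite !big_cons; apply: (le_trans (measureU2 P _ _)) => //.
  exact: bigsetU_measurable.
exact: leeD.
Qed.

Definition cylinder {T R : Type} (r0 : R) (xi : nat -> T -> R) (w : seq R) :
    set T :=
  \bigcap_(k in [set` iota 0 (size w)]) (xi k @^-1` [set nth r0 w k]).

Lemma cylinder_prob (R : realType) (d : measure_display) (T : measurableType d)
    (P : probability T R) (xi : nat -> {RV P >-> R}) n (w : seq R) :
  mutually_independent xi -> (forall k, fair_sign (xi k)) ->
  w \in sign_words R n ->
  P (cylinder 0 (fun k => xi k : T -> R) w) = (2^-1 ^+ n)%:E.
Proof.
move=> indep fair; rewrite mem_sign_words => /andP[/eqP <- /allP wsign].
rewrite /cylinder.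
rewrite (indep (iota 0 (size w)) (fun k => [set w`_k])) ?iota_uniq //.
rewrite big_seq (eq_bigr (fun=> (2^-1)%:E)) => [|k]; last first.
  rewrite mem_iota /= add0n => kw; have := wsign w`_k (mem_nth 0 kw).
  by rewrite !inE => /orP[] /eqP ->; have [] := fair k.
rewrite -big_seq big_const_seq count_predT size_iota.
by elim: (size w) => [|m IH] //=; rewrite IH exprS.
Qed.

Lemma measurable_cylinder (R : realType) (d : measure_display)
    (T : measurableType d) (P : probability T R) (xi : nat -> {RV P >-> R}) w :
  measurable (cylinder 0 (fun k => xi k : T -> R) w).
Proof.
by apply: bigcap_measurableType => k _; apply: measurable_funPTI.
Qed.

Lemma fair_sign_ae (R : realType) (d : measure_display) (T : measurableType d)
    (P : probability T R) (X : {RV P >-> R}) :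
  fair_sign X -> {ae P, forall t, X t \in [:: 1; -1]}.
Proof.
have half2 : 2^-1 + 2^-1 = 1 :> R by field.
move=> [P1 PN1].
have m1 : measurable (X @^-1` [set 1]) by apply: measurable_funPTI.
have mN1 : measurable (X @^-1` [set -1]) by apply: measurable_funPTI.
exists (~` (X @^-1` [set 1] `|` X @^-1` [set -1])); split.
- by apply: measurableC; apply: measurableU.
- rewrite probability_setC; last exact: measurableU.
  rewrite measureU //; last first.
    apply/seteqP; split => // t [/= -> H]; exfalso; move: H; clear; lra.
  have -> : (P (X @^-1` [set 1%R]) + P (X @^-1` [set (-1)%R]) = 1)%E.
    by rewrite P1 PN1 -EFinD half2.
  by rewrite subee.
- apply: subsetC => t /= H; rewrite !inE; case: H => ->; rewrite eqxx ?orbT //.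
Qed.

Definition sym_itv {R : realType} (x r : R) : set R := `[x - r, x + r]%classic.

Lemma sym_itvE (R : realType) (x r y : R) :
  sym_itv x r y = (`|y - x| <= r) :> Prop.
Proof. by rewrite /sym_itv /= in_itv /= ler_distl. Qed.

(** Almost surely [X] is within [l ^+ n / (1 - l)] of the value of the word of the first [n] signs,
    so [X] in the interval forces that word to be close to [x]. Each word has probability
    [2^-1 ^+ n]. *)
Lemma convolution_itv_le (R : realType) (l : R) (mu : probability R R) n x r :
  0 < l < 1 -> is_bernoulli_convolution l mu ->
  (mu (sym_itv x r) <=
   (\sum_(w <- sign_words R n)
      2^-1 ^+ n * (`|horner_rec w l - x| <= r + l ^+ n / (1 - l))%R%:R)%:E)%E.
Proof.
move=> l01 [d [T [P [xi [X [indep fair conv muE]]]]]].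
have sgn : {ae P, forall t, forall k, xi k t \in [:: 1; -1]}.
  by apply: ae_foralln => k; exact: fair_sign_ae.
(* [N] is a measurable null set containing every outcome with a value other than 1 and -1 or with a
   series not tending to [X]. *)
have [N [mN PN NE]] := filterI sgn conv.
have mI : measurable (sym_itv x r) by exact: measurable_itv.
rewrite muE // /distribution /pushforward.
pose near_x (w : seq R) := `|horner_rec w l - x| <= r + l ^+ n / (1 - l).
pose C w := if near_x w then cylinder 0 (fun k => xi k : T -> R) w else set0.
have mC w : measurable (C w).
  by rewrite /C; case: ifP => // _; exact: measurable_cylinder.
have sub : X @^-1` sym_itv x r `<=`
    N `|` \big[setU/set0]_(w <- sign_words R n) C w.
  move=> t; rewrite /= sym_itvE => Xx.
  have [Nt|Nt] := pselect (N t); [by left|right].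
  have [sg cv] : (forall k, xi k t \in [:: 1; -1]) /\
     series (fun k => xi k t * l ^+ k) @ \oo --> X t.
    by apply: contrapT => H; apply: Nt; apply: NE.
  pose w := mkseq (fun k => xi k t) n.
  have wn : w \in sign_words R n.
    rewrite mem_sign_words size_mkseq eqxx /=; apply/allP => a /mapP[k _ ->].
    exact: sg.
  rewrite -bigcup_seq; exists w => //=.
  have -> : C w = cylinder 0 (fun k => xi k : T -> R) w.
    rewrite /C ifT // /near_x horner_rec_series.
    have sg1 k : `|xi k t| <= 1.
      by move: (sg k); rewrite !inE => /orP[] /eqP ->; rewrite ?normrN normr1.
    have := @series_tail_le R (fun k => xi k t) l (X t) n l01 sg1 cv.
    move: (series _ n) => S H.
    rewrite -(subrKA (X t)) (le_trans (ler_normD _ _)) // addrC lerD //.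
    by rewrite distrC.
  move=> k /=; rewrite mem_iota add0n size_mkseq => kn.
  by rewrite nth_mkseq.
have mX : measurable (X @^-1` sym_itv x r) by exact: measurable_funPTI.
apply: (@le_trans _ _ (P (N `|` \big[setU/set0]_(w <- sign_words R n) C w))).
  by rewrite le_measure ?inE //;
    apply: measurableU => //; exact: bigsetU_measurable.
apply: (le_trans (measureU2 P _ _)) => //; first exact: bigsetU_measurable.
apply: (@le_trans _ _ (P N + \sum_(w <- sign_words R n) P (C w))%E).
  by apply: leeD => //; exact: measure_bigsetU_le.
have -> : P N = 0%E by exact: PN.
rewrite add0e.
rewrite -sumEFin big_seq [leRHS]big_seq; apply: lee_sum => w wn.
rewrite /C -/(near_x w); case: (near_x w); last by rewrite measure0 mulr0.
by rewrite mulr1 (cylinder_prob _ _ _ _ _ n).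
Qed.

(** * Potential estimate and mass distribution principle *)

Lemma geometric_nneseries_le (R : realType) (D r : R) : 0 <= D -> 0 <= r < 1 ->
  (\sum_(0 <= n <oo) (D * r ^+ n)%:E <= (D / (1 - r))%:E)%E.
Proof.
move=> D0 /andP[r0 r1]; apply: lime_le.
  by apply: is_cvg_nneseries => n _ _; rewrite lee_fin mulr_ge0 ?exprn_ge0.
apply: nearW => n; rewrite sumEFin lee_fin.
have -> : \sum_(0 <= i < n) D * r ^+ i = series (geometric D r) n by [].
rewrite geometric_seriesE ?lt_eqF // ler_pM2r ?invr_gt0 ?subr_gt0 //.
by rewrite ler_piMr // gerBl exprn_ge0.
Qed.

(* [G] is a sublevel set of the potential [\sum_n t^-n g_n], which is
   integrable. *)
Lemma frostman_set (R : realType) (mu : probability R R) (r : nat -> R)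
    (g : nat -> R -> \bar R) (D q t : R) :
  (forall n, measurable_fun [set: R] (g n)) -> (forall n x, 0 <= g n x)%E ->
  (forall n x, mu (sym_itv x (r n)) <= g n x)%E ->
  (forall n, \int[mu]_x g n x <= (D * q ^+ n)%:E)%E ->
  0 <= D -> 0 <= q < t ->
  exists (K : R) (G : set R), [/\ 0 < K, measurable G, (0 < mu G)%E &
    forall x n, G x -> (mu (sym_itv x (r n)) <= (K * t ^+ n)%:E)%E].
Proof.
move=> mg g0 mug ig D0 /andP[q0 qt].
have t0 : 0 < t by exact: le_lt_trans qt.
pose phi x := (\sum_(0 <= n <oo) ((t ^- n)%:E * g n x))%E.
have tn0 n : 0 < t ^- n by rewrite invr_gt0 exprn_gt0.
have mt n : measurable_fun setT (fun x => (t ^- n)%:E * g n x)%E.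
  by apply: emeasurable_funM.
have t0g n x : (0 <= (t ^- n)%:E * g n x)%E.
  by rewrite mule_ge0 // lee_fin ltW.
have phi0 x : (0 <= phi x)%E by apply: nneseries_ge0.
have mphi : measurable_fun setT phi.
  by apply: ge0_emeasurable_sum.
set F := D / (1 - q / t).
have qt1 : q / t < 1 by rewrite ltr_pdivrMr // mul1r.
have iphi : (\int[mu]_x phi x <= F%:E)%E.
  rewrite integral_nneseries //.
  apply: le_trans (geometric_nneseries_le _ _ (q / t) D0 _); last first.
    by rewrite divr_ge0 // ltW.
  apply: lee_nneseries => [n _ _|n _]; first exact: integral_ge0.
  rewrite ge0_integralZl_EFin //; last exact: ltW.
  apply: (le_trans (lee_wpmul2l _ (ig n))); first by rewrite lee_fin ltW.
  by rewrite -EFinM lee_fin expr_div_n mulrCA mulrA mulrC mulrCA mulrC.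
have F0 : 0 <= F by rewrite divr_ge0 // subr_ge0 ltW.
have K0 : 0 < F + 1 by lra.
exists (F + 1), (~` [set x | (F + 1)%:E <= `|phi x|]%E).
have mB : measurable [set x | (F + 1)%:E <= `|phi x|]%E.
  rewrite -[X in measurable X]setTI; apply: emeasurable_fun_c_infty => //.
  exact: measurableT_comp.
split => //; first exact: measurableC.
(* By Markov's inequality, a null [G] would give [F + 1 <= F], since [F] bounds the integral of
   [phi]. *)
- rewrite lt0e measure_ge0 andbT; apply/eqP => B0.
  have B1 : mu [set x | (F + 1)%:E <= `|phi x|]%E = 1%E.
    have := probability_setC mu (measurableC mB); rewrite setCK => ->.
    by rewrite B0 sube0.
  have : ((F + 1)%:E * mu [set x | ((F + 1)%:E <= `|phi x|)%E]
          <= \int[mu]_x `|phi x|)%E.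
    by rewrite -[X in mu X]setTI; exact: le_integral_abse.
  rewrite B1 mule1 => H.
  have : ((F + 1)%:E <= F%:E)%E.
    apply: (le_trans H); apply: le_trans iphi.
    by under eq_integral do rewrite gee0_abs //.
  by rewrite lee_fin; lra.
- move=> x n /= /negP; rewrite -ltNge gee0_abs // => phix.
  apply: (le_trans (mug n x)).
  have : ((t ^- n)%:E * g n x <= (F + 1)%:E)%E.
    apply: le_trans (ltW phix).
    have := @nneseries_lim_ge R (fun n => (t ^- n)%:E * g n x)%E
      xpredT 0%N n.+1.
    move=> /(_ (fun k _ _ => t0g k x)); apply: le_trans.
    by rewrite big_nat_recr //= leeDr // sume_ge0.
  by rewrite muleC EFinM -lee_pdivlMr // invrK.
Qed.

Lemma expr_bracket (R : realType) (l d : R) : 0 < l < 1 -> 0 < d <= 1 ->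
  exists n, l ^+ n.+1 < d <= l ^+ n.
Proof.
move=> /andP[l0 l1] /andP[d0 d1].
have ex : exists n, l ^+ n < d.
  have : l ^+ n @[n --> \oo] --> 0 by apply: cvg_expr; rewrite ger0_norm ?ltW.
  move=> /cvgr_lt /(_ d d0) [N _ HN]; exists N; exact: HN (leqnn N).
case: (ex_minnP ex) => -[|n] nd nmin.
  by move: nd; rewrite expr0 ltNge d1.
exists n; rewrite nd leNgt; apply/negP => /nmin; by rewrite ltnn.
Qed.

(** Rounding [d] up to a power of [l] extends the bound from the radii [l ^+ n] to all radii up to
    1; the rounding costs the division by [l] to the power [s]. *)
Lemma ball_growth (R : realType) (mu : probability R R) (l s K x d : R) :
  0 < l < 1 -> 0 < s -> 0 < K -> 0 <= d <= 1 ->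
  (forall n, mu (sym_itv x (l ^+ n)) <= (K * (l `^ s) ^+ n)%:E)%E ->
  (mu (sym_itv x d) <= (K / l `^ s * d `^ s)%:E)%E.
Proof.
move=> l01 s0 K0 /andP[d0 d1] H; have /andP[l0 l1] := l01.
have t0 : 0 < l `^ s by rewrite powR_gt0.
have t1 : l `^ s < 1.
  have := @gt0_ltr_powR R s s0 l 1; rewrite powR1 !nnegrE; apply => //.
  exact: ltW.
have mono a b : a <= b -> (mu (sym_itv x a) <= mu (sym_itv x b))%E.
  move=> ab; rewrite le_measure ?inE //; try exact: measurable_itv.
  by move=> y; rewrite !sym_itvE => /le_trans; apply.
have [->|dn0] := eqVneq d 0; last first.
  have d01 : 0 < d <= 1 by rewrite lt_neqAle eq_sym dn0 d0.
  have [n /andP[nd dn]] := expr_bracket _ _ _ l01 d01.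
  apply: (le_trans (mono _ _ dn)); apply: (le_trans (H n)).
  have E : (l `^ s) ^+ n.+1 = (l ^+ n.+1) `^ s.
    by rewrite -(powR_mulrn n.+1 (ltW t0)) powRAC (powR_mulrn n.+1 (ltW l0)).
  rewrite lee_fin -mulrA ler_pM2l // -[leLHS](mulKf (lt0r_neq0 t0)) -exprS E.
  rewrite ler_pM2l ?invr_gt0 // ge0_ler_powR ?(ltW s0) ?(ltW nd) ?nnegrE //.
  by rewrite exprn_ge0 // ltW.
(* For [d = 0] the claim is that [x] is not an atom, which follows by letting [n] tend to infinity
   in the hypothesis. *)
rewrite powR0 ?gt_eqF // mulr0.
have : (K * (l `^ s) ^+ n)%:E @[n --> \oo] --> (K * 0)%:E.
  apply: cvg_EFin; first by apply: nearW.
  by apply: cvgMr; apply: cvg_expr; rewrite ger0_norm // ltW.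
rewrite mulr0 => cv.
rewrite -(cvg_lim _ cv) //; apply: lime_ge.
  by apply/cvg_ex; eexists; exact: cv.
apply: nearW => n; apply: le_trans (H n); apply: mono.
by rewrite exprn_ge0 // ltW.
Qed.

(** A piece of the cover meeting [G] lies in an interval centred at a point of [G] with the diameter
    as radius, whose mass [ball_growth] bounds. There are two exponents because [s'] may be 0 while
    [ball_growth] needs a positive one. *)
Lemma cover_sum_ge (R : realType) (mu : probability R R) (l s s' K : R)
    (X G : set R) (U : (set R)^nat) :
  0 < l < 1 -> 0 < s -> s' <= s -> 0 < K ->
  measurable X -> mu X = 1%E -> measurable G ->
  (forall x n, G x -> (mu (sym_itv x (l ^+ n)) <= (K * (l `^ s) ^+ n)%:E)%E) ->
  X `<=` \bigcup_i U i -> (forall i, diameter (U i) <= 1%:E)%E ->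
  (mu G <= (K / l `^ s)%:E * \sum_(0 <= i <oo) diameter_pow s' (U i))%E.
Proof.
move=> l01 s0 s's K0 mX X1 mG ballG XU dU; have /andP[l0 l1] := l01.
have C0 : 0 <= K / l `^ s by rewrite divr_ge0 ?powR_ge0 // ltW.
have pow0 i : (0 <= diameter_pow s' (U i))%E.
  by rewrite /diameter_pow; case: ifP => // _; exact: poweR_ge0.
have dist i x y : U i x -> U i y -> (`|x - y|%:E <= diameter (U i))%E.
  by move=> Ux Uy; apply: ereal_sup_ubound; right; exists x => //; exists y.
have diam_fin i : exists2 e, diameter (U i) = e%:E & 0 <= e <= 1.
  have d0 : (0 <= diameter (U i))%E by apply: ereal_sup_ubound; left.
  move: d0 (dU i); case: (diameter (U i)) => [e| |] //.
  by rewrite !lee_fin => e0 e1; exists e => //; rewrite e0.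
(* The sets [U i] need not be measurable; each is replaced by a measurable [V i] containing its
   trace on [G]. *)
have [V HV] : exists V : nat -> set R, forall i,
    [/\ measurable (V i), G `&` U i `<=` V i &
        (mu (V i) <= (K / l `^ s)%:E * diameter_pow s' (U i))%E].
  suff /choice[V HV] : forall i, exists V : set R,
      [/\ measurable V, G `&` U i `<=` V &
        (mu V <= (K / l `^ s)%:E * diameter_pow s' (U i))%E] by exists V.
  move=> i; have [e eE /andP[e0 e1]] := diam_fin i.
  have [[x [Gx Ux]]|GU] := pselect (exists x, G x /\ U i x); last first.
    exists set0; split => //; last by rewrite measure0 mule_ge0.
    by move=> x [Gx Ux]; apply: GU; exists x.
  exists (sym_itv x e); split; first exact: measurable_itv.
    move=> y [_ Uy]; rewrite sym_itvE.
    by have := dist i y x Uy Ux; rewrite eE lee_fin.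
  rewrite /diameter_pow ifF; last first.
    by apply/negbTE/eqP => U0; move: Ux; rewrite U0.
  have e01 : 0 <= e <= 1 by rewrite e0.
  apply: (le_trans (@ball_growth R mu l s K x e l01 s0 K0 e01
    (fun n => ballG x n Gx))).
  rewrite eE poweR_EFin -EFinM lee_fin ler_wpM2l //.
  (* At diameter 0 the left power is 0 because [s > 0], while the right one is 1 if [s' = 0]. *)
  have [->|en0] := eqVneq e 0; first by rewrite powR0 ?gt_eqF // powR_ge0.
  by apply: ger_powR s's; rewrite lt_neqAle eq_sym en0 e0.
have mV i : measurable (V i) by have [] := HV i.
have mcX : measurable (~` X) by exact: measurableC.
have mUV : measurable (\bigcup_i V i) by exact: bigcup_measurable.
apply: (@le_trans _ _ (mu (~` X `|` \bigcup_i V i))).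
  rewrite le_measure ?inE //; first exact: measurableU.
  move=> x Gx; have [Xx|Xx] := pselect (X x); [right|by left].
  have [i _ Ux] := XU x Xx; exists i => //.
  by have [_ sub _] := HV i; apply: sub.
apply: (@le_trans _ _ (mu (~` X) + mu (\bigcup_i V i))%E).
  exact: measureU2.
have -> : mu (~` X) = 0%E by rewrite probability_setC // X1 subee.
rewrite add0e.
apply: (@le_trans _ _ (\sum_(0 <= i <oo) mu (V i))%E).
  exact: measure_sigma_subadditive.
rewrite -nneseriesZl //; apply: lee_nneseries => // i _.
by have [] := HV i.
Qed.

(** Otherwise some [X] of full measure has zero [s']-dimensional measure with [s' < alpha], hence
    covers with arbitrarily small sums, against [cover_sum_ge]. *)
Lemma hausdorff_dim_measure_ge (R : realType) (mu : probability R R)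
    (g : nat -> R -> \bar R) (l q D alpha : R) :
  0 < l < 1 ->
  (forall n, measurable_fun setT (g n)) -> (forall n x, 0 <= g n x)%E ->
  (forall n x, mu (sym_itv x (l ^+ n)) <= g n x)%E ->
  (forall n, \int[mu]_x g n x <= (D * q ^+ n)%:E)%E ->
  0 <= D -> 0 <= q <= l `^ alpha ->
  (alpha%:E <= hausdorff_dim_measure mu)%E.
Proof.
move=> l01 mg g0 mug ig D0 /andP[q0 qa]; have /andP[l0 l1] := l01.
apply: le_ereal_inf_tmp => _ [X [mX X1] <-].
apply: le_ereal_inf_tmp => _ [s' [s'0 HX] <-].
rewrite lee_fin leNgt; apply/negP => s'a.
(* The midpoint is positive since [0 <= s' < alpha], and being below [alpha] it gives the strict
   inequality on [q] that [frostman_set] requires. *)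
pose s := (s' + alpha) / 2.
have [s's sa s0] : [/\ s' <= s, s < alpha & 0 < s] by rewrite /s; split; lra.
have qt : 0 <= q < l `^ s.
  rewrite q0 (le_lt_trans qa) // /powR gt_eqF // ltr_expR ltr_nM2r //.
  by rewrite ln_lt0 // l0.
have [K [G [K0 mG G0 ballG]]] :=
  frostman_set R mu (fun n => l ^+ n) g D q _ mg g0 mug ig D0 qt.
have C0 : 0 < K / l `^ s by rewrite divr_gt0 ?powR_gt0.
have Gfin : mu G \is a fin_num by exact: fin_num_measure.
have m0 : 0 < fine (mu G) by rewrite fine_gt0 // G0 ltey_eq Gfin.
have : (hausdorff_premeasure s' 1 X < (fine (mu G) / (K / l `^ s))%:E)%E.
  apply: (@le_lt_trans _ _ 0%E); last by rewrite lte_fin divr_gt0.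
  by rewrite -HX; apply: ereal_sup_ubound; exists 1 => //=; exact: ltr01.
move=> /ereal_inf_lt[_ [U [XU dU] <-]]; rewrite ltNge => /negP; apply.
rewrite EFinM muleC lee_pdivrMl // fineK //.
exact: cover_sum_ge XU dU.
Qed.

(** * Application to the Bernoulli convolution *)

(** The radius is [l ^+ n] enlarged by the tail [l ^+ n / (1 - l)]. This finite sum of interval
    indicators is a measurable majorant of the mass [mu (sym_itv x (l ^+ n))] as a function of
    [x]. *)
Definition conv_ball {R : realType} (l : R) n (x : R) : \bar R :=
  (\sum_(w <- sign_words R n)
    ((2^-1 ^+ n)%:E *
     (\1_(sym_itv (horner_rec w l) ((1 + (1 - l)^-1) * l ^+ n)) x)%:E))%E.

Lemma measurable_conv_ball (R : realType) (l : R) n :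
  measurable_fun setT (conv_ball l n).
Proof.
apply: emeasurable_sum => w; apply: emeasurable_funM => //.
by apply/measurable_EFinP; apply: measurable_indic; exact: measurable_itv.
Qed.

Lemma indic_sym_itv (R : realType) (c r x : R) :
  \1_(sym_itv c r) x = (`|c - x| <= r)%R%:R :> R.
Proof.
rewrite indicE; congr (_%:R); congr nat_of_bool.
by apply/idP/idP; rewrite inE sym_itvE distrC.
Qed.

Lemma measure_le_conv_ball (R : realType) (l : R) (mu : probability R R) n x :
  0 < l < 1 -> is_bernoulli_convolution l mu ->
  (mu (sym_itv x (l ^+ n)) <= conv_ball l n x)%E.
Proof.
move=> l01 conv.
apply: (le_trans (@convolution_itv_le R l mu n x _ l01 conv)).
rewrite -sumEFin; apply: lee_sum => w _.
by rewrite -EFinM indic_sym_itv lee_fin mulrDl mul1r [_^-1 * _]mulrC.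
Qed.

(** Integrating each indicator gives the mass of an interval around a word value, and
    [convolution_itv_le] applies a second time. This yields a double sum over words, where the
    weight [4 ^- n] cancels the [4 ^ n] of [near_pair_count]. *)
Lemma integral_conv_ball (R : realType) (l : R) (mu : probability R R) n :
  0 < l < 1 -> is_bernoulli_convolution l mu ->
  (\int[mu]_x conv_ball l n x <=
   ((gauss_bump l (1 + 2 / (1 - l)))^-1 * gauss_rate l ^+ n)%:E)%E.
Proof.
move=> l01 conv; have /andP[l0 l1] := l01.
have h0 : 0 <= 2^-1 ^+ n :> R by rewrite exprn_ge0 // invr_ge0.
have mI w : measurable (sym_itv (horner_rec w l) ((1 + (1 - l)^-1) * l ^+ n)).
  exact: measurable_itv.
have mEI w : measurable_fun setT
   (fun x => (\1_(sym_itv (horner_rec w l)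
      ((1 + (1 - l)^-1) * l ^+ n)) x)%:E : \bar R).
  by apply/measurable_EFinP; exact: measurable_indic.
rewrite ge0_integral_sum //; last by move=> w; apply: emeasurable_funM.
under eq_bigr => w _.
  rewrite ge0_integralZl_EFin //.
  rewrite integral_indic // setIT.
  over.
(* [L] collects the radius [l ^+ n] and one tail [l ^+ n / (1 - l)] for each of the two words. *)
pose L := 1 + 2 / (1 - l).
apply: (@le_trans _ _ (\sum_(w <- sign_words R n) ((2^-1 ^+ n)%:E *
  (\sum_(v <- sign_words R n) 2^-1 ^+ n *
     (`|horner_rec v l - horner_rec w l| <= L * l ^+ n)%R%:R)%:E))%E).
  apply: lee_sum => w _; apply: lee_wpmul2l; first by rewrite lee_fin.
  apply: (le_trans (@convolution_itv_le R l mu n _ _ l01 conv)).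
  rewrite lee_fin le_eqVlt; apply/orP; left; apply/eqP; apply: eq_bigr => v _.
  congr (_ * (_ : bool)%:R); congr (_ <= _).
  by rewrite /L; field; rewrite subr_eq0 gt_eqF.
under eq_bigr do rewrite -EFinM.
rewrite sumEFin lee_fin -mulr_sumr.
under eq_bigr do rewrite -mulr_sumr.
rewrite -mulr_sumr mulrA -exprMn exchange_big /=.
have L0 : 0 <= L by rewrite addr_ge0 // divr_ge0 // subr_ge0 ltW.
have := near_pair_count R l L n l01 L0.
move=> /(ler_wpM2l (exprn_ge0 n (_ : 0 <= 2^-1 * 2^-1))).
move=> /(_ (ltac:(by rewrite mulr_ge0 ?invr_ge0))) H.
apply: (le_trans H); rewrite mulrA -exprMn mulrC.
rewrite (_ : 2^-1 * 2^-1 * (4 * gauss_rate l) = gauss_rate l) //; by field.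
Qed.

Theorem theorem1p8 (R : realType) :
  exists c eps : R, [/\ 0 < c, 0 < eps &
    forall lambda : R, 0 < lambda < 1 -> 1 - eps < lambda ->
    forall mu : probability R R, is_bernoulli_convolution lambda mu ->
      ((1 - c * (1 - lambda))%:E <= hausdorff_dim_measure mu)%E].
Proof.
(* Both constants come from [gauss_rate_le_powR]: the exponent [1 - 5 (1 - l)], valid for
   [l > 1/2]. *)
exists 5, 2^-1; split => // l l01 l2 mu conv; have /andP[l0 l1] := l01.
apply: (@hausdorff_dim_measure_ge R mu (conv_ball l) l (gauss_rate l)
  (gauss_bump l (1 + 2 / (1 - l)))^-1) => //.
- by move=> n; exact: measurable_conv_ball.
- by move=> n x; apply: sume_ge0 => w _; rewrite mule_ge0 // lee_fin ?exprn_ge0.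
- by move=> n x; exact: measure_le_conv_ball.
- by move=> n; exact: integral_conv_ball.
- by rewrite invr_ge0 expR_ge0.
- rewrite gauss_rate_le_powR ?andbT.
    by rewrite divr_ge0 ?addr_ge0 ?expR_ge0.
  by rewrite l1 andbT; lra.
Qed.
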